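(* There exists an absolute constant $\epsilon_0<1$ such that the following holds. Any algorithm that, given a parameter $\epsilon\in(0,\epsilon_0]$ and sample access to product distributions $P,Q$ over $\{0,1\}^n$, distinguishes between $\|P-Q\|_1<\epsilon/2$ and $\|P-Q\|_1>\epsilon$ with probability at least $2/3$ requires $\Omega(n/\log n)$ samples. Moreover, the lower bound still holds in the case where $Q$ is known and provided as an explicit parameter.
   Context: A product distribution over $\{0,1\}^n$ is one with independent coordinates. $\|P-Q\|_1=\sum_x|P(x)-Q(x)|$. *)

(* Defs.v *)
From HB Require Import structures.
From mathcomp Require Import all_boot all_order all_algebra.
From mathcomp Require Import all_classical all_reals all_analysis.

Set Implicit Arguments.
Unset Strict Implicit.
Unset Printing Implicit Defensive.

Import Order.TTheory GRing.Theory Num.Theory.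

Local Open Scope ring_scope.

Notation cube n := {ffun 'I_n -> bool}.

Definition is_distribution (R : realType) (T : finType) (P : {ffun T -> R})
    : Prop :=
  (forall x, 0 <= P x) /\ \sum_x P x = 1.

Definition l1dist (R : realType) (T : finType) (P Q : {ffun T -> R}) : R :=
  \sum_x `|P x - Q x|.

Definition marginal (R : realType) (n : nat) (P : {ffun cube n -> R})
    (i : 'I_n) (b : bool) : R :=
  \sum_(x : cube n | x i == b) P x.

(* The coordinates are independent: the joint mass function is the product of
   the mass functions of the coordinates. *)
Definition is_product_distribution (R : realType) (n : nat)
    (P : {ffun cube n -> R}) : Prop :=
  is_distribution P /\ forall x, P x = \prod_(i < n) marginal P i (x i).

Definition iid (R : realType) (T : finType) (P : {ffun T -> R}) (m : nat)
    (s : m.-tuple T) : R :=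
  \prod_(i < m) P (tnth s i).

(* A randomized algorithm enters only through its acceptance function: the
   probability, over its internal randomness, that it answers "close" on the
   given samples; it answers "far" otherwise. *)
Definition accept_prob (R : realType) (T : finType) (P : {ffun T -> R})
    (m : nat) (A : m.-tuple T -> R) : R :=
  \sum_(s : m.-tuple T) iid P s * A s.

Definition accept_prob2 (R : realType) (T : finType) (P Q : {ffun T -> R})
    (mP mQ : nat) (A : mP.-tuple T -> mQ.-tuple T -> R) : R :=
  \sum_(s : mP.-tuple T) \sum_(t : mQ.-tuple T) iid P s * iid Q t * A s t.

(* [a] is the probability of the answer "close", [d] the L1 distance. *)
Definition correct_answer (R : realType) (eps d a : R) : Prop :=
  (d < eps / 2 -> 2 / 3 <= a) /\ (eps < d -> 2 / 3 <= 1 - a).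

Definition closeness_tester (R : realType) (n : nat) (eps : R) (mP mQ : nat)
    (A : mP.-tuple (cube n) -> mQ.-tuple (cube n) -> R) : Prop :=
  (forall s t, 0 <= A s t <= 1) /\
  forall P Q : {ffun cube n -> R},
    is_product_distribution P -> is_product_distribution Q ->
    correct_answer eps (l1dist P Q) (accept_prob2 P Q A).

(* Here the algorithm receives the whole mass function of [Q] as input. *)
Definition identity_tester (R : realType) (n : nat) (eps : R) (m : nat)
    (A : {ffun cube n -> R} -> m.-tuple (cube n) -> R) : Prop :=
  (forall Q s, 0 <= A Q s <= 1) /\
  forall P Q : {ffun cube n -> R},
    is_product_distribution P -> is_product_distribution Q ->
    correct_answer eps (l1dist P Q) (accept_prob P (A Q)).

(* Main.v *)
Require Import Defs.
From HB Require Import structures.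
From mathcomp Require Import all_boot all_order all_algebra.
From mathcomp Require Import all_classical all_reals all_analysis.
From mathcomp Require Import ring lra zify.

(** Let [Q] be the product of [n] Bernoulli variables of mean [delta / n], with
[delta = 4 eps], and let [P] have means [delta * X_i / n] for i.i.d. random
[X_i].  Two laws of [X] are used, [near_prior] and [far_prior], supported on the
nodes [0], [1], [25] and [K (k+1)^2] for [k < L].  They are the negative and the
positive part of the weights of the divided difference at these nodes, so their
moments of order less than [L + 2] agree.  The quadratic growth of the large
nodes gives them a negligible weight: [near_prior] is almost concentrated at
[1], whereas [far_prior] has most of its mass at [0].  Hence [P] is close to [Q]
under [near_prior], and under [far_prior] the points of the cube with a single
nonzero coordinate already show that it is far from [Q]; by Markov's inequality,
a tester accepts noticeably more often under [near_prior].

The [n] columns of a sample are independent, and the law of a column of length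
[m] is a mixture of polynomials in the mean.  Matching moments make the two laws
of a column differ by at most [(1 + 8 K L^2 / n)^m / 4^(L + 2)] in L1, which is
at most [1 / (16 * 2^L)] as soon as [16 K L m <= n].  With [2^L >= n] the
samples do not separate the two cases, so a tester needs more than
[n / (16 K L)] samples. *)

Set Implicit Arguments.
Unset Strict Implicit.
Unset Printing Implicit Defensive.

Import Order.TTheory GRing.Theory Num.Theory.
Local Open Scope ring_scope.

(** * Expectations and L1 distance *)

Definition expect (R : realType) (T : finType) (P : {ffun T -> R})
    (f : T -> R) : R :=
  \sum_x P x * f x.

Section Expectation.
Variables (R : realType) (T : finType).
Implicit Types (P Q : {ffun T -> R}) (f g : T -> R).

Lemma eq_expect P f g : f =1 g -> expect P f = expect P g.
Proof. by move=> fg; apply: eq_bigr => x _; rewrite fg. Qed.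

Lemma expect_cst P (c : R) : is_distribution P -> expect P (fun=> c) = c.
Proof. by case=> _ P1; rewrite /expect -mulr_suml P1 mul1r. Qed.

Lemma expectZ P (c : R) f : expect P (fun x => c * f x) = c * expect P f.
Proof. by rewrite /expect mulr_sumr; apply: eq_bigr => x _; rewrite mulrCA. Qed.

Lemma expectB P f g :
  expect P (fun x => f x - g x) = expect P f - expect P g.
Proof. by rewrite /expect -sumrB; apply: eq_bigr => x _; rewrite mulrBr. Qed.

Lemma expect_sum P (I : finType) (F : I -> T -> R) :
  expect P (fun x => \sum_i F i x) = \sum_i expect P (F i).
Proof.
by rewrite /expect exchange_big; apply: eq_bigr => x _; rewrite mulr_sumr.
Qed.

Lemma ler_expect P f g : is_distribution P -> (forall x, f x <= g x) ->
  expect P f <= expect P g.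
Proof. by case=> P0 _ fg; apply: ler_sum => x _; rewrite ler_wpM2l. Qed.

Lemma expect_itv P f (a b : R) : is_distribution P ->
  (forall x, a <= f x <= b) -> a <= expect P f <= b.
Proof.
move=> Pd fab; apply/andP; split.
  by rewrite -(expect_cst a Pd); apply: ler_expect => // x; case/andP: (fab x).
rewrite -[leRHS](expect_cst b Pd).
by apply: ler_expect => // x; case/andP: (fab x).
Qed.

Lemma expect_markov P f g (c t : R) : is_distribution P -> 0 <= c -> 0 < t ->
  (forall x, 0 <= f x) -> (forall x, 0 <= g x) ->
  (forall x, f x < t -> c <= g x) -> c * (1 - expect P f / t) <= expect P g.
Proof.
move=> Pd c0 t0 f0 g0 fg.
have -> : c * (1 - expect P f / t) = expect P (fun x => c * (1 - t^-1 * f x)).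
  by rewrite expectZ expectB expectZ expect_cst // [t^-1 * _]mulrC.
apply: ler_expect => // x; have [ft|tf] := ltP (f x) t.
  apply: le_trans (fg x ft); rewrite ler_piMr // gerBl.
  by rewrite mulr_ge0 // invr_ge0 ltW.
apply: le_trans (g0 x).
by rewrite mulr_ge0_le0 // subr_le0 ler_pdivlMl // mulr1.
Qed.

Lemma dist_expect_le_l1dist P Q f : (forall x, 0 <= f x <= 1) ->
  `|expect P f - expect Q f| <= l1dist P Q.
Proof.
move=> f01; rewrite /expect -sumrB.
apply: le_trans (ler_norm_sum _ _ _) _; apply: ler_sum => x _.
have /andP[f0 f1] := f01 x.
by rewrite -mulrBl normrM (ger0_norm f0) ler_piMr.
Qed.

Lemma l1dist_telescope (P : nat -> {ffun T -> R}) (n : nat) :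
  l1dist (P 0%N) (P n) <= \sum_(k < n) l1dist (P k) (P k.+1).
Proof.
rewrite /l1dist exchange_big; apply: ler_sum => x _ /=.
rewrite distrC -(telescope_sumr (fun k => P k x) (leq0n n)) big_mkord.
apply: le_trans (ler_norm_sum _ _ _) _.
by apply: ler_sum => k _; rewrite distrC.
Qed.

End Expectation.

(** * Product distributions and mixtures *)

Definition prod_distr (R : realType) (I J : finType) (mu : I -> {ffun J -> R}) :
    {ffun {ffun I -> J} -> R} :=
  [ffun a : {ffun I -> J} => \prod_i mu i (a i)].

Section ProductDistribution.
Variables (R : realType) (I J : finType).
Implicit Types mu nu : I -> {ffun J -> R}.

Lemma prod_distrP mu : (forall i, is_distribution (mu i)) ->
  is_distribution (prod_distr mu).
Proof.
move=> mu_d; split=> [a|].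
  by rewrite ffunE prodr_ge0 // => i _; case: (mu_d i).
under eq_bigr do rewrite ffunE.
by rewrite -(bigA_distr_bigA (fun i => mu i)) big1 // => i _; case: (mu_d i).
Qed.

Lemma expect_prod_distr mu (i : I) (h : J -> R) :
  (forall k, is_distribution (mu k)) ->
  expect (prod_distr mu) (fun a => h (a i)) = expect (mu i) h.
Proof.
move=> mu_d; pose u k j := mu k j * (if k == i then h j else 1).
transitivity (\sum_(a : {ffun I -> J}) \prod_k u k (a k)).
  apply: eq_bigr => a _; rewrite ffunE big_split /=; congr (_ * _).
  by rewrite (bigD1 i) //= eqxx big1 ?mulr1 // => k /negbTE ->.
rewrite -(bigA_distr_bigA u) (bigD1 i) //= [X in _ * X]big1 => [|k /negbTE ki].
  by rewrite mulr1; apply: eq_bigr => j _; rewrite /u eqxx.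
by rewrite /u ki; under eq_bigr do rewrite mulr1; case: (mu_d k).
Qed.

Lemma l1dist_prod_distr1 mu nu (k : I) :
  (forall i, is_distribution (mu i)) -> (forall i, i != k -> nu i = mu i) ->
  l1dist (prod_distr mu) (prod_distr nu) = l1dist (mu k) (nu k).
Proof.
move=> mu_d numu; pose u i c := if i == k then `|mu k c - nu k c| else mu i c.
transitivity (\sum_(x : {ffun I -> J}) \prod_i u i (x i)).
  apply: eq_bigr => x _; rewrite !ffunE.
  rewrite !(bigD1 k isT) /= [in u k]/u eqxx.
  have -> : \prod_(i | i != k) nu i (x i) = \prod_(i | i != k) mu i (x i).
    by apply: eq_bigr => i ik; rewrite numu.
  rewrite -mulrBl normrM [X in _ * X]ger0_norm; last first.
    by apply: prodr_ge0 => i _; case: (mu_d i).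
  by congr (_ * _); apply: eq_bigr => i /negbTE ik; rewrite /u ik.
rewrite -(bigA_distr_bigA u) (bigD1 k) //= [X in _ * X]big1 => [|i /negbTE ik].
  by rewrite mulr1; apply: eq_bigr => c _; rewrite /u eqxx.
by rewrite /u ik; case: (mu_d i).
Qed.

End ProductDistribution.

Lemma l1dist_prod_distr_le (R : realType) (J : finType) (n : nat)
    (mu nu : 'I_n -> {ffun J -> R}) :
  (forall i, is_distribution (mu i)) -> (forall i, is_distribution (nu i)) ->
  l1dist (prod_distr mu) (prod_distr nu) <= \sum_i l1dist (mu i) (nu i).
Proof.
move=> mu_d nu_d; pose hybrid k (i : 'I_n) := if (i < k)%N then nu i else mu i.
have -> : prod_distr mu = prod_distr (hybrid 0%N) by [].
have -> : prod_distr nu = prod_distr (hybrid n).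
  apply/ffunP => a; rewrite !ffunE.
  by apply: eq_bigr => i _; rewrite /hybrid ltn_ord.
apply: le_trans (l1dist_telescope (fun k => prod_distr (hybrid k)) n) _.
apply: ler_sum => k _; rewrite (l1dist_prod_distr1 (k := k)).
- by rewrite /hybrid ltnn ltnSn.
- by move=> i; rewrite /hybrid; case: ifP.
- by move=> i /negbTE ik; rewrite /hybrid ltnS leq_eqVlt val_eqE ik.
Qed.

Lemma marginal_prod_distr (R : realType) (n : nat)
    (mu : 'I_n -> {ffun bool -> R}) (i : 'I_n) (b : bool) :
  (forall i, is_distribution (mu i)) -> marginal (prod_distr mu) i b = mu i b.
Proof.
move=> mu_d; rewrite /marginal big_mkcond.
transitivity (expect (prod_distr mu) (fun x => (x i == b)%:R)).
  by apply: eq_bigr => x _; rewrite mulr_natr mulrb.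
rewrite (expect_prod_distr i (fun c => (c == b)%:R)) // /expect.
under eq_bigr do rewrite mulr_natr mulrb.
by rewrite -big_mkcond big_pred1_eq.
Qed.

Lemma prod_distr_is_product (R : realType) (n : nat)
    (mu : 'I_n -> {ffun bool -> R}) :
  (forall i, is_distribution (mu i)) -> is_product_distribution (prod_distr mu).
Proof.
move=> mu_d; split; first exact: prod_distrP.
by move=> x; rewrite ffunE; apply: eq_bigr => i _; rewrite marginal_prod_distr.
Qed.

Definition mixture (R : realType) (J T : finType) (mu : {ffun J -> R})
    (kern : J -> {ffun T -> R}) : {ffun T -> R} :=
  [ffun x => expect mu (fun j => kern j x)].

Lemma expect_mixture (R : realType) (J T : finType) (mu : {ffun J -> R})
    (kern : J -> {ffun T -> R}) (f : T -> R) :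
  expect (mixture mu kern) f = expect mu (fun j => expect (kern j) f).
Proof.
rewrite expect_sum; apply: eq_bigr => x _.
by rewrite ffunE /expect mulr_suml; apply: eq_bigr => j _; rewrite mulrA.
Qed.

Lemma mixtureP (R : realType) (J T : finType) (mu : {ffun J -> R})
    (kern : J -> {ffun T -> R}) :
  is_distribution mu -> (forall j, is_distribution (kern j)) ->
  is_distribution (mixture mu kern).
Proof.
move=> mu_d kern_d; split=> [x|].
  rewrite ffunE; apply: sumr_ge0 => j _.
  by rewrite mulr_ge0 //; [case: mu_d | case: (kern_d j)].
under eq_bigr do rewrite ffunE.
rewrite -expect_sum -[RHS](expect_cst 1 mu_d); apply: eq_expect => j.
by case: (kern_d j).
Qed.

Lemma mixture_prod_distr (R : realType) (I J T : finType)
    (mu : I -> {ffun J -> R}) (kern : J -> {ffun T -> R}) :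
  mixture (prod_distr mu) (fun a => prod_distr (fun i => kern (a i)))
    = prod_distr (fun i => mixture (mu i) kern).
Proof.
apply/ffunP => x; rewrite !ffunE.
under [RHS]eq_bigr do rewrite ffunE.
rewrite (bigA_distr_bigA (fun i j => mu i j * kern j (x i))).
by apply: eq_bigr => a _; rewrite !ffunE big_split.
Qed.

(** * Samples from mixtures of product distributions *)

Section Samples.
Variable R : realType.

Definition ffun_transpose (I J : finType) (T : Type)
    (c : {ffun I -> {ffun J -> T}}) : {ffun J -> {ffun I -> T}} :=
  [ffun j => [ffun i => c i j]].

Lemma ffun_transposeK (I J : finType) (T : Type) :
  cancel (@ffun_transpose I J T) (@ffun_transpose J I T).
Proof. by move=> c; apply/ffunP => i; apply/ffunP => j; rewrite !ffunE. Qed.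

Lemma accept_probE (T : finType) (P : {ffun T -> R}) (m : nat)
    (A : m.-tuple T -> R) :
  accept_prob P A = expect (prod_distr (fun=> P)) (A \o @tuple_of_finfun T m).
Proof.
rewrite /accept_prob (reindex (@tuple_of_finfun T m)) /=; last first.
  apply: onW_bij; exists (@finfun_of_tuple T m).
    exact: tuple_of_finfunK.
  exact: finfun_of_tupleK.
apply: eq_bigr => f _; rewrite ffunE; congr (_ * _).
by apply: eq_bigr => t _; rewrite tnth_mktuple.
Qed.

Lemma accept_prob_itv (T : finType) (P : {ffun T -> R}) (m : nat)
    (A : m.-tuple T -> R) :
  is_distribution P -> (forall s, 0 <= A s <= 1) -> 0 <= accept_prob P A <= 1.
Proof.
move=> Pd A01; rewrite accept_probE; apply: expect_itv => [|f]; last exact: A01.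
exact: prod_distrP.
Qed.

Lemma expect_prod_distr_transpose (I J T : finType)
    (mu : I -> J -> {ffun T -> R}) (f : {ffun I -> {ffun J -> T}} -> R) :
  expect (prod_distr (fun i => prod_distr (mu i))) f
    = expect (prod_distr (fun j => prod_distr (mu^~ j)))
        (f \o @ffun_transpose J I T).
Proof.
rewrite /expect (reindex (@ffun_transpose J I T)) /=; last first.
  apply: onW_bij; exists (@ffun_transpose I J T); exact: ffun_transposeK.
apply: eq_bigr => c _; congr (_ * _); rewrite !ffunE.
under eq_bigr do rewrite !ffunE; under [RHS]eq_bigr do rewrite !ffunE.
rewrite exchange_big; apply: eq_bigr => j _; apply: eq_bigr => i _.
by rewrite !ffunE.
Qed.

Definition column_law (J C : finType) (kern : J -> {ffun C -> R}) (m : nat)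
    (mu : {ffun J -> R}) : {ffun {ffun 'I_m -> C} -> R} :=
  mixture mu (fun j => prod_distr (fun=> kern j)).

Variables (J C : finType) (kern : J -> {ffun C -> R}).
Hypothesis kernP : forall j, is_distribution (kern j).

Lemma column_lawP (m : nat) (mu : {ffun J -> R}) :
  is_distribution mu -> is_distribution (column_law kern m mu).
Proof. by move=> mu_d; apply: mixtureP => // j; apply: prod_distrP. Qed.

Definition mean_accept (n m : nat) (A : m.-tuple {ffun 'I_n -> C} -> R)
    (mu : {ffun J -> R}) : R :=
  expect (prod_distr (fun _ : 'I_n => mu))
    (fun a => accept_prob (prod_distr (fun i => kern (a i))) A).

Lemma mean_acceptE (n m : nat) (A : m.-tuple {ffun 'I_n -> C} -> R)
    (mu : {ffun J -> R}) :
  mean_accept A mu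
    = expect (prod_distr (fun _ : 'I_n => column_law kern m mu))
        (A \o @tuple_of_finfun _ m \o @ffun_transpose _ _ C).
Proof.
rewrite -mixture_prod_distr expect_mixture; apply: eq_expect => a.
by rewrite accept_probE expect_prod_distr_transpose.
Qed.

Lemma dist_mean_accept_le (n m : nat) (A : m.-tuple {ffun 'I_n -> C} -> R)
    (mu nu : {ffun J -> R}) :
  is_distribution mu -> is_distribution nu -> (forall s, 0 <= A s <= 1) ->
  `|mean_accept A mu - mean_accept A nu|
    <= n%:R * l1dist (column_law kern m mu) (column_law kern m nu).
Proof.
move=> mu_d nu_d A01; rewrite !mean_acceptE.
apply: le_trans (dist_expect_le_l1dist _ _ _) _ => [c|]; first exact: A01.
apply: le_trans (l1dist_prod_distr_le _ _) _ => [i|i|]; try exact: column_lawP.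
by rewrite sumr_const card_ord mulr_natl.
Qed.

End Samples.

(** * Products of Bernoulli distributions *)

Definition bern (R : realType) (p : R) : {ffun bool -> R} :=
  [ffun b => if b then p else 1 - p].

Lemma bernP (R : realType) (p : R) : 0 <= p <= 1 -> is_distribution (bern p).
Proof.
case/andP=> p0 p1; split=> [b|].
  by rewrite ffunE; case: b; rewrite ?subr_ge0.
by rewrite big_bool !ffunE /= addrC subrK.
Qed.

Lemma l1dist_bern (R : realType) (p q : R) :
  l1dist (bern p) (bern q) = 2 * `|p - q|.
Proof.
rewrite /l1dist big_bool !ffunE (_ : 1 - p - (1 - q) = - (p - q)); last by ring.
by rewrite normrN mulr_natl mulr2n.
Qed.

Definition bern_prod (R : realType) (n : nat) (p : 'I_n -> R) :
    {ffun cube n -> R} :=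
  prod_distr (fun i => bern (p i)).

Lemma bern_prodP (R : realType) (n : nat) (p : 'I_n -> R) :
  (forall i, 0 <= p i <= 1) -> is_product_distribution (bern_prod p).
Proof. by move=> p01; apply: prod_distr_is_product => i; exact: bernP. Qed.

Lemma l1dist_bern_prod_le (R : realType) (n : nat) (p q : 'I_n -> R) :
  (forall i, 0 <= p i <= 1) -> (forall i, 0 <= q i <= 1) ->
  l1dist (bern_prod p) (bern_prod q) <= 2 * \sum_i `|p i - q i|.
Proof.
move=> p01 q01; apply: le_trans (l1dist_prod_distr_le _ _) _ => [i|i|].
- exact: bernP.
- exact: bernP.
by rewrite mulr_sumr; under eq_bigr do rewrite l1dist_bern.
Qed.

Lemma prod_one_sub_ge (R : realDomainType) (I : Type) (r : seq I) (P : pred I)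
    (f : I -> R) :
  (forall i, P i -> 0 <= f i <= 1) ->
  1 - \sum_(i <- r | P i) f i <= \prod_(i <- r | P i) (1 - f i).
Proof.
move=> f01; suff /andP[] : (\prod_(i <- r | P i) (1 - f i) <= 1)
    && (1 - \sum_(i <- r | P i) f i <= \prod_(i <- r | P i) (1 - f i)) by [].
elim/big_rec2: _ => [|i s p /f01/andP[f0 f1] /andP[p1 sp]].
  by rewrite subr0 lexx.
have : 0 <= (1 - f i) * (1 - p) by rewrite mulr_ge0 ?subr_ge0.
have : 0 <= f i * (1 - p) by rewrite mulr_ge0 ?subr_ge0.
by move=> ? ?; apply/andP; split; lra.
Qed.

(* Only the points of the cube with a single nonzero coordinate, at a place
   where [p] vanishes, are counted. *)
Lemma l1dist_bern_prod_ge (R : realType) (n : nat) (p q : 'I_n -> R) :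
  (forall i, 0 <= q i <= 1) ->
  (\sum_(i | p i == 0) q i) * (1 - \sum_i q i)
    <= l1dist (bern_prod p) (bern_prod q).
Proof.
move=> q01; pose unit_vec (i : 'I_n) : cube n := [ffun k => k == i].
have unit_vec_inj : injective unit_vec.
  by move=> i j /ffunP/(_ i); rewrite !ffunE eqxx => /esym/eqP.
have unit_vecE (r : 'I_n -> R) i :
    bern_prod r (unit_vec i) = r i * \prod_(k | k != i) (1 - r k).
  rewrite ffunE (bigD1 i) //= !ffunE eqxx; congr (_ * _).
  by apply: eq_bigr => k /negbTE ki; rewrite !ffunE ki.
rewrite /l1dist (bigID (mem (unit_vec @: [set i | p i == 0]))) /=.
apply: ler_wpDr; first by apply: sumr_ge0.
rewrite big_imset /=; last by move=> i j _ _; apply: unit_vec_inj.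
rewrite mulr_suml; under [leRHS]eq_bigl do rewrite inE.
apply: ler_sum => i /eqP pi0.
rewrite unit_vecE pi0 mul0r sub0r normrN unit_vecE.
apply: le_trans (ler_norm _); have /andP[qi0 _] := q01 i; rewrite ler_wpM2l //.
apply: le_trans (prod_one_sub_ge _ (fun k _ => q01 k)).
by rewrite lerD2l lerN2 [leRHS](bigD1 i) //= lerDr.
Qed.

(** * Mixtures with matching moments *)

Definition eq_moments (R : realType) (J : finType) (D : nat) (x : J -> R)
    (mu nu : {ffun J -> R}) : Prop :=
  forall t, (t < D)%N ->
    expect mu (fun j => x j ^+ t) = expect nu (fun j => x j ^+ t).

Lemma eq_momentsZ (R : realType) (J : finType) (D : nat) (c : R) (x : J -> R)
    (mu nu : {ffun J -> R}) :
  eq_moments D x mu nu -> eq_moments D (fun j => c * x j) mu nu.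
Proof.
move=> eq_x t /eq_x eq_xt; under eq_expect do rewrite exprMn.
by under [RHS]eq_expect do rewrite exprMn; rewrite !expectZ eq_xt.
Qed.

Lemma sum_expr_card (R : comPzSemiRingType) (I : finType) (x : R) :
  \sum_(S : {set I}) x ^+ #|S| = (x + 1) ^+ #|I|.
Proof.
have -> : (x + 1) ^+ #|I| = \prod_(i : I) (x + 1) by rewrite prodr_const.
rewrite bigA_distr; apply: eq_bigr => S _.
by rewrite -big_mkcond prodr_const.
Qed.

Section ColumnMoments.
Variables (R : realType) (m : nat).
Implicit Types (c : {ffun 'I_m -> bool}) (S : {set 'I_m}) (p : R).

(* [bern p b] is [(-1) ^+ (~~ b) * p + (~~ b)%:R]; in the expansion of the
   product, [S] is the set of factors from which the linear term is taken. *)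
Definition bern_coef c S : R :=
  \prod_t (if t \in S then (-1) ^+ ~~ c t else (~~ c t)%:R).

Lemma prod_bernE p c :
  prod_distr (fun=> bern p) c = \sum_S bern_coef c S * p ^+ #|S|.
Proof.
rewrite ffunE.
under eq_bigr => t _.
  have -> : bern p (c t) = (-1) ^+ (~~ c t) * p + (~~ c t)%:R.
    by rewrite ffunE; case: (c t); rewrite ?(expr0, expr1) /=; ring.
  over.
rewrite bigA_distr; apply: eq_bigr => S _.
rewrite -prodr_const [X in _ * X]big_mkcond -big_split.
apply: eq_bigr => t _ /=.
by case: ifP => _ //=; rewrite mulr1.
Qed.

Lemma sum_norm_bern_coef S : \sum_c `|bern_coef c S| = 2 ^+ #|S|.
Proof.
under eq_bigr do rewrite normr_prod.
rewrite -(bigA_distr_bigA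
  (fun t b => `|if t \in S then (-1) ^+ ~~ b else (~~ b)%:R|)).
rewrite -prodr_const [RHS]big_mkcond; apply: eq_bigr => t _; rewrite big_bool.
by case: ifP => _; rewrite /= ?expr0 ?expr1 ?normrN ?normr1 ?normr0 ?add0r.
Qed.

Variables (J : finType) (mu nu : {ffun J -> R}) (x : J -> R).
Variables (D : nat) (r b : R).
Hypotheses (mu_d : is_distribution mu) (nu_d : is_distribution nu).
Hypotheses (x_itv : forall j, 0 <= x j <= b) (r_ge1 : 1 <= r).
Hypothesis mu_nu : eq_moments D x mu nu.

(* [r ^+ t / r ^+ D] is at least [1] for [D <= t]; with it, the sum over [t] in
   [l1dist_column_law_le] is a full binomial sum. *)
Lemma dist_moment_le t : 0 <= b ->
  `|expect mu (fun j => x j ^+ t) - expect nu (fun j => x j ^+ t)|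
    <= (r * b) ^+ t / r ^+ D.
Proof.
move=> b0; have r0 : 0 < r by apply: lt_le_trans r_ge1.
have [tD|Dt] := ltnP t D.
  by rewrite mu_nu // subrr normr0 divr_ge0 ?exprn_ge0 ?mulr_ge0 // ltW.
have xt_itv j : 0 <= x j ^+ t <= b ^+ t.
  by have /andP[xj0 xjb] := x_itv j; rewrite exprn_ge0 //= lerXn2r ?nnegrE.
apply: (@le_trans _ _ (b ^+ t)).
  have /andP[? ?] := expect_itv mu_d xt_itv.
  have /andP[? ?] := expect_itv nu_d xt_itv.
  by rewrite ler_norml; apply/andP; split; lra.
rewrite exprMn mulrAC ler_peMl ?exprn_ge0 //.
by rewrite ler_pdivlMr ?exprn_gt0 // mul1r ler_weXn2l.
Qed.

Lemma l1dist_column_law_le : 0 <= b ->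
  l1dist (column_law (fun j => bern (x j)) m mu)
         (column_law (fun j => bern (x j)) m nu)
    <= (1 + 2 * r * b) ^+ m / r ^+ D.
Proof.
move=> b0; pose M t :=
  `|expect mu (fun j => x j ^+ t) - expect nu (fun j => x j ^+ t)|.
have column_lawE lam c : column_law (fun j => bern (x j)) m lam c
    = \sum_S bern_coef c S * expect lam (fun j => x j ^+ #|S|).
  rewrite ffunE; under eq_expect do rewrite prod_bernE.
  by rewrite expect_sum; apply: eq_bigr => S _; rewrite expectZ.
apply: (@le_trans _ _ (\sum_(S : {set 'I_m}) 2 ^+ #|S| * M #|S|)).
  under [leRHS]eq_bigr do rewrite -sum_norm_bern_coef mulr_suml.
  rewrite exchange_big; apply: ler_sum => c _ /=.
  rewrite !column_lawE -sumrB; apply: le_trans (ler_norm_sum _ _ _) _.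
  by apply: ler_sum => S _; rewrite -mulrBr normrM.
have -> : (1 + 2 * r * b) ^+ m / r ^+ D
    = \sum_(S : {set 'I_m}) 2 ^+ #|S| * ((r * b) ^+ #|S| / r ^+ D).
  rewrite addrC -[m in LHS]card_ord -sum_expr_card mulr_suml.
  by apply: eq_bigr => S _; rewrite mulrA -exprMn mulrA.
by apply: ler_sum => S _; rewrite ler_wpM2l ?exprn_ge0 // dist_moment_le.
Qed.

End ColumnMoments.

(** * Two priors with matching moments *)

Lemma sum_divided_difference_exp (F : fieldType) (x : nat -> F) (N t : nat) :
  injective x -> (t < N)%N ->
  \sum_(j < N.+1) x j ^+ t / \prod_(i < N.+1 | i != j) (x j - x i) = 0.
Proof.
move=> x_inj ltN.
have Xt_size : (size ('X^t : {poly F}) <= N.+1)%N by rewrite size_polyXn ltnW.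
have Xt_lagrange := lagrange_gen (ltn0Sn N) x_inj Xt_size.
transitivity (('X^t : {poly F})`_N); last by rewrite coefXn gtn_eqF.
rewrite Xt_lagrange coef_sum; apply: eq_bigr => j _.
rewrite lagrangeE // hornerXn !coefCM horner_prod.
under [in RHS]eq_bigr do rewrite hornerXsubC.
set l := \prod_(i < N.+1 | _) ('X - _).
have l_size : size l = N.+1.
  rewrite /l -big_filter size_prod_XsubC.
  by case: big_enumP => s _ _ [_ ->]; rewrite cardC1 card_ord.
have /monicP : l \is monic by apply: monic_prod => i _; apply: monicXsubC.
by rewrite /lead_coef l_size => ->; rewrite mulr1.
Qed.

Lemma sum_inv_sqr_le2 (R : realFieldType) (L : nat) :
  \sum_(k < L) (k.+1%:R ^+ 2)^-1 <= 2 :> R.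
Proof.
case: L => [|l]; first by rewrite big_ord0.
suff : \sum_(k < l.+1) (k.+1%:R ^+ 2)^-1 <= 2 - l.+1%:R^-1 :> R.
  by move=> /le_trans; apply; rewrite lerBlDr lerDl invr_ge0.
elim: l => [|l IHl].
  by rewrite big_ord_recr big_ord0 /= add0r expr1n invr1; lra.
rewrite big_ord_recr /=; apply: le_trans (lerD IHl (lexx _)) _.
rewrite -[l.+2]addn1 natrD; move: (l.+1%:R : R) (ltr0Sn R l) => x x0.
rewrite -subr_ge0.
have -> : 2 - (x + 1)^-1 - (2 - x^-1 + ((x + 1) ^+ 2)^-1)
    = (x * (x + 1) ^+ 2)^-1.
  by field; apply/andP; split; lra.
by rewrite invr_ge0 mulr_ge0 ?sqr_ge0 // ltW.
Qed.

Lemma prod_succ_neq (R : comPzSemiRingType) (k L : nat) : (k < L)%N ->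
  k.+1%:R * \prod_(i < L | i != k :> nat) i.+1%:R = L`!%:R :> R.
Proof.
move=> kL; rewrite fact_prod big_add1 big_mkord natr_prod.
by rewrite [RHS](bigD1 (Ordinal kL)).
Qed.

Lemma prod_shift_fact (m l : nat) :
  (m`! * \prod_(i < l) (m + i.+1) = (m + l)`!)%N.
Proof.
elim: l => [|l IHl]; first by rewrite big_ord0 muln1 addn0.
by rewrite big_ord_recr mulnA IHl /= addnS factS mulnC.
Qed.

Lemma prod_succ_div_dist (R : numFieldType) (k L : nat) : (k < L)%N ->
  \prod_(i < L | i != k :> nat) (i.+1%:R / `|k%:R - i%:R|)
    = 'C(L, k.+1)%:R :> R.
Proof.
move=> kL; rewrite prodf_div.
have dist_prod : \prod_(i < L | i != k :> nat) `|k%:R - i%:R|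
    = (k`! * (L - k.+1)`!)%:R :> R.
  have [j ->] : exists j, L = (k + j.+1)%N by exists (L - k.+1)%N; lia.
  rewrite -[X in (X - _)%N]addSnnS addKn big_split_ord natrM; congr (_ * _).
    rewrite -ffactnn ffact_prod natr_prod.
    apply: eq_big => [i|i _]; first by rewrite /= ltn_eqF.
    by rewrite -natrB ?normr_nat //= ltnW.
  rewrite big_mkcond big_ord_recl /= addn0 eqxx mul1r.
  rewrite fact_prod big_add1 big_mkord natr_prod.
  apply: eq_bigr => i _; rewrite ifT; last by rewrite /= /bump; lia.
  by rewrite natrD opprD addNKr normrN normr_nat.
have k_neq0 : k.+1%:R != 0 :> R by rewrite pnatr_eq0.
apply: (mulfI k_neq0); rewrite mulrA prod_succ_neq // dist_prod.
rewrite -(bin_fact kL) factS !natrM.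
have k_fact_neq0 : k`!%:R != 0 :> R by rewrite pnatr_eq0 -lt0n fact_gt0.
have Lk_fact_neq0 : (L - k.+1)`!%:R != 0 :> R.
  by rewrite pnatr_eq0 -lt0n fact_gt0.
by field; apply/andP.
Qed.

Lemma prod_succ_div_add (R : numFieldType) (k L : nat) : (k < L)%N ->
  \prod_(i < L | i != k :> nat) (i.+1%:R / (k.+1 + i.+1)%:R)
    = 2 / 'C(k.+1 + L, k.+1)%:R :> R.
Proof.
move=> kL; rewrite prodf_div.
have := congr1 (fun a => a%:R : R) (bin_fact (leq_addr L k.+1)).
rewrite addKn -prod_shift_fact (bigD1 (Ordinal kL)) //= factS !natrM natr_prod.
rewrite natrD -(prod_succ_neq R kL).
set N := \prod_(_ < _ | _) _; set D := \prod_(_ < _ | _) _.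
set B : R := 'C(_, _)%:R => binE.
have k_neq0 : k.+1%:R != 0 :> R by rewrite pnatr_eq0.
have k_fact_neq0 : k`!%:R != 0 :> R by rewrite pnatr_eq0 -lt0n fact_gt0.
have D_neq0 : D != 0 by apply/prodf_neq0 => i _; rewrite pnatr_eq0.
have B_neq0 : B != 0 by rewrite pnatr_eq0 -lt0n bin_gt0 leq_addr.
apply/eqP; rewrite eqr_div //; apply/eqP.
apply: (mulfI k_fact_neq0); apply: (mulfI k_neq0); apply: (mulfI k_neq0).
transitivity (B * (k.+1%:R * k`!%:R * (k.+1%:R * N))); first by ring.
by rewrite binE; ring.
Qed.

Lemma prod_sqr_div_dist_le2 (R : realFieldType) (k L : nat) : (k < L)%N ->
  \prod_(i < L | i != k :> nat)
      (i.+1%:R ^+ 2 / `|k.+1%:R ^+ 2 - i.+1%:R ^+ 2|) <= 2 :> R.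
Proof.
move=> kL.
have -> : \prod_(i < L | i != k :> nat)
      (i.+1%:R ^+ 2 / `|k.+1%:R ^+ 2 - i.+1%:R ^+ 2|)
    = 'C(L, k.+1)%:R * (2 / 'C(k.+1 + L, k.+1)%:R) :> R.
  rewrite -prod_succ_div_dist // -prod_succ_div_add // -big_split /=.
  apply: eq_bigr => i _; rewrite mulf_div -expr2; congr (_ / _).
  rewrite subr_sqr normrM -natrD normr_nat.
  by rewrite -[k.+1%:R]natr1 -[i.+1%:R]nat1r addrKA.
rewrite mulrCA ger_pMr // ler_pdivrMr ?ltr0n ?bin_gt0 ?leq_addr //.
by rewrite mul1r ler_nat leq_bin2l ?leq_addl.
Qed.

(* The node [25] adds to the weights of the large nodes the factor that makes
   the bound of [sum_tail_weight_le] independent of [L]. *)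
Definition node (R : pzRingType) (K : R) (j : nat) : R :=
  match j with
  | 0%N => 0
  | 1%N => 1
  | 2%N => 25
  | k.+3 => K * k.+1%:R ^+ 2
  end.

(* Divided difference of order [L.+2] at the nodes, scaled so that the weight of
   the node [0] does not depend on [L]. *)
Definition node_weight (R : fieldType) (K : R) (L j : nat) : R :=
  \prod_(k < L) (- node K k.+3)
    / \prod_(i < L.+3 | i != j :> nat) (node K j - node K i).

Lemma big_ord_recl3 (T : Type) (idx : T) (op : Monoid.law idx) (n : nat)
    (P : pred nat) (F : nat -> T) :
  \big[op/idx]_(i < n.+3 | P i) F i
    = op (op (op (if P 0 then F 0 else idx) (if P 1 then F 1 else idx))
             (if P 2 then F 2 else idx))
         (\big[op/idx]_(k < n | P k.+3) F k.+3).
Proof.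
by rewrite big_mkcond [in RHS]big_mkcond !big_ord_recl /= !Monoid.mulmA.
Qed.

Section NodeWeights.
Variables (R : realFieldType) (K : R) (L : nat).
Hypothesis K_ge : 100 <= K.

Let K_gt0 : 0 < K. Proof. have := K_ge; lra. Qed.

Lemma node_ge k : K <= node K k.+3.
Proof. by rewrite /= ler_peMr ?(ltW K_gt0) // exprn_ege1 // ler1n. Qed.

Lemma node_lt i j : (i < j)%N -> node K i < node K j.
Proof.
have big_lt k l : (k < l)%N -> node K k.+3 < node K l.+3.
  by move=> kl; rewrite /= ltr_pM2l // ltrXn2r ?nnegrE // ltr_nat.
have big_gt k : 25 < node K k.+3 by have := K_ge; have := node_ge k; lra.
case: i j => [|[|[|i]]] [|[|[|j]]] // ij; try exact: big_lt;
  try (by have := big_gt j; rewrite [node K j.+3]lock /=; lra);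
  by rewrite /=; lra.
Qed.

Lemma node_inj : injective (node K).
Proof.
move=> i j; apply: contra_eq; rewrite neq_ltn => /orP[] /node_lt ij.
  by rewrite lt_eqF.
by rewrite gt_eqF.
Qed.

Lemma node_le j : (0 < L)%N -> (j < L.+3)%N -> 0 <= node K j <= K * L%:R ^+ 2.
Proof.
move=> L0 jL; apply/andP; split.
  by case: j jL => [|j] _ //; apply/ltW/(@node_lt 0).
have -> : K * L%:R ^+ 2 = node K L.-1.+3 by rewrite /= prednK.
have : (j <= L.-1.+3)%N by lia.
by rewrite leq_eqVlt => /predU1P[-> //|/node_lt/ltW].
Qed.

Lemma sum_node_weight_exp t : (t < L.+2)%N ->
  \sum_(j < L.+3) node_weight K L j * node K j ^+ t = 0.
Proof.
move=> /(sum_divided_difference_exp node_inj) dd0.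
rewrite -[RHS](mulr0 (\prod_(k < L) (- node K k.+3))) -[in RHS]dd0 mulr_sumr.
by apply: eq_bigr => j _; rewrite /node_weight mulrAC mulrA.
Qed.

Lemma sum_node_weight : \sum_(j < L.+3) node_weight K L j = 0.
Proof.
rewrite -[RHS](sum_node_weight_exp (ltn0Sn L.+1)).
by apply: eq_bigr => j _; rewrite mulr1.
Qed.

Lemma sum_inv_node_le : \sum_(k < L) (node K k.+3)^-1 <= 2 / K.
Proof.
under eq_bigr do rewrite /= invfM.
by rewrite -mulr_sumr mulrC ler_pM2r ?invr_gt0 // sum_inv_sqr_le2.
Qed.

Lemma node_ratio_bounds (c : R) : 0 <= c <= 25 ->
  0 <= \prod_(k < L) (- node K k.+3) / \prod_(k < L) (c - node K k.+3) <= 2.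
Proof.
move=> /andP[c0 c25].
have node_gt k : 0 < node K k.+3 by apply: lt_le_trans (node_ge k).
have c_lt k : c < node K k.+3 by have := K_ge; have := node_ge k; lra.
have -> : \prod_(k < L) (- node K k.+3) / \prod_(k < L) (c - node K k.+3)
    = (\prod_(k < L) (1 - c / node K k.+3))^-1.
  rewrite -prodf_div -prodfV; apply: eq_bigr => k _.
  by rewrite -[c - _]opprB; field; rewrite subr_eq0 !gt_eqF.
have quot_itv (k : 'I_L) : true -> 0 <= c / node K k.+3 <= 1.
  by move=> _; rewrite divr_ge0 ?(ltW (node_gt _)) // ler_pdivrMr // mul1r ltW.
have sum_le : \sum_(k < L) c / node K k.+3 <= 1 / 2.
  rewrite -mulr_sumr; apply: le_trans (ler_wpM2l c0 sum_inv_node_le) _.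
  by rewrite mulrA ler_pdivrMr //; have := K_ge; lra.
have prod_ge := prod_one_sub_ge (index_enum 'I_L) quot_itv.
have prod_gt : 1 / 2 <= \prod_(k < L) (1 - c / node K k.+3) by lra.
by rewrite invr_ge0 -div1r ler_pdivrMr; lra.
Qed.

Lemma node_weight0 : node_weight K L 0 = 1 / 25.
Proof.
have neq0 : \prod_(k < L) (- node K k.+3) != 0.
  apply/prodf_neq0 => k _; rewrite oppr_eq0 gt_eqF //.
  exact: lt_le_trans (node_ge k).
rewrite /node_weight (big_ord_recl3 *%R L (fun i => i != 0%N)
  (fun i => node K 0 - node K i)).
under [X in _ / (_ * X)]eq_bigr do rewrite sub0r.
by rewrite !sub0r invfM mulrCA divff //=; field.
Qed.

Lemma node_weight1_le0 : node_weight K L 1 <= 0.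
Proof.
have := node_ratio_bounds (c := 1); rewrite ler01 ler1n.
move=> /(_ isT)/andP[ratio_ge0 _].
rewrite /node_weight (big_ord_recl3 *%R L (fun i => i != 1%N)
  (fun i => node K 1 - node K i)).
rewrite invfM mulrCA [X in X^-1 * _](_ : _ = - 24); last by rewrite /=; ring.
by rewrite mulr_le0_ge0 // invr_le0; lra.
Qed.

Lemma node_weight2_bounds : 0 <= node_weight K L 2 <= 1 / 300.
Proof.
have := node_ratio_bounds (c := 25); rewrite ler0n lexx => /(_ isT).
rewrite /node_weight (big_ord_recl3 *%R L (fun i => i != 2%N)
  (fun i => node K 2 - node K i)).
rewrite invfM mulrCA [X in X^-1 * _](_ : _ = 600); last by rewrite /=; ring.
set ratio := \prod_(k < L) - _ / _; lra.
Qed.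

Lemma norm_node_weightE (k : 'I_L) :
  `|node_weight K L k.+3|
    = (\prod_(i < L | i != k :> nat)
        (i.+1%:R ^+ 2 / `|k.+1%:R ^+ 2 - i.+1%:R ^+ 2|))
      / ((node K k.+3 - 1) * (node K k.+3 - 25)).
Proof.
have node_gt i : 25 < node K i.+3 by have := K_ge; have := node_ge i; lra.
have x_gt := node_gt k; have x_ge25 := ltW x_gt.
have x_ge1 : 1 <= node K k.+3 by lra.
have x_ge0 : 0 <= node K k.+3 by lra.
rewrite /node_weight (big_ord_recl3 *%R L (fun i => i != k.+3)
  (fun i => node K k.+3 - node K i)).
rewrite normrM normfV !normrM !normr_prod (bigD1 k) //=.
rewrite subr0 normrN !ger0_norm ?subr_ge0 // -/(node K k.+3).
set N := \prod_(_ < _ | _) _; set D := \prod_(_ < _ | _) _.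
have D_neq0 : D != 0.
  apply/prodf_neq0 => i ik; rewrite normr_eq0 subr_eq0.
  by rewrite -/(node K i.+3) (inj_eq node_inj) eq_sym.
transitivity (N / D / ((node K k.+3 - 1) * (node K k.+3 - 25))).
  by move: (node K k.+3) x_gt => x x_gt; field; rewrite D_neq0 !gt_eqF //; lra.
congr (_ / _); rewrite -prodf_div; apply: eq_bigr => i _.
rewrite normrN -mulrBr !(normrM K) normrX normr_nat -mulf_div divff ?mul1r //.
by rewrite normr_eq0 gt_eqF.
Qed.

Lemma sum_tail_weight_le :
  \sum_(k < L) `|node_weight K L k.+3| * (node K k.+3 - 1) <= 8 / K.
Proof.
apply: (@le_trans _ _ (4 * \sum_(k < L) (node K k.+3)^-1)); last first.
  by have := sum_inv_node_le; lra.
rewrite mulr_sumr; apply: ler_sum => k _; rewrite norm_node_weightE.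
have := prod_sqr_div_dist_le2 R (ltn_ord k); set r := \prod_(_ < _ | _) _ => r2.
have nodek := node_ge k; set x := node K k.+3 in nodek *.
have x_ge : 50 <= x by have := K_ge; lra.
have -> : r / ((x - 1) * (x - 25)) * (x - 1) = r / (x - 25).
  by field; rewrite !subr_eq0 !gt_eqF //; lra.
rewrite ler_pdivrMr ?subr_gt0; last by lra.
rewrite mulrAC ler_pdivlMr; last by lra.
have : r * x <= 2 * x by rewrite ler_wpM2r //; lra.
lra.
Qed.

End NodeWeights.

Definition jordan_pos (R : realType) (J : finType) (v : J -> R) :
    {ffun J -> R} :=
  [ffun j => v^\+ j / \sum_i v^\+ i].

Definition jordan_neg (R : realType) (J : finType) (v : J -> R) :
    {ffun J -> R} :=
  jordan_pos (\- v).

Section JordanParts.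
Variables (R : realType) (J : finType).
Implicit Types (v x h : J -> R).

Lemma jordan_posP v : 0 < \sum_j v^\+ j -> is_distribution (jordan_pos v).
Proof.
move=> mass_gt0; split=> [j|].
  by rewrite ffunE divr_ge0 ?funrpos_ge0 // ltW.
by under eq_bigr do rewrite ffunE; rewrite -mulr_suml divff // gt_eqF.
Qed.

Lemma expect_jordan_pos v h :
  expect (jordan_pos v) h = (\sum_j v^\+ j * h j) / \sum_j v^\+ j.
Proof.
by rewrite /expect mulr_suml; apply: eq_bigr => j _; rewrite ffunE mulrAC.
Qed.

Lemma sum_funrposN v :
  \sum_j v j = 0 -> \sum_j (\- v)^\+ j = \sum_j v^\+ j.
Proof.
move=> v_sum0; apply/esym/subr0_eq.
rewrite -sumrB -[RHS]v_sum0; apply: eq_bigr => j _.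
by rewrite funrposN -[in RHS](funrposBneg v).
Qed.

Lemma eq_moments_jordan v x (D : nat) :
  \sum_j v j = 0 ->
  (forall t, (t < D)%N -> \sum_j v j * x j ^+ t = 0) ->
  eq_moments D x (jordan_pos v) (jordan_neg v).
Proof.
move=> v_sum0 moment0 t /moment0 vt0.
rewrite !expect_jordan_pos sum_funrposN //.
congr (_ / _); apply: subr0_eq; rewrite -sumrB -[RHS]vt0; apply: eq_bigr => j _.
by rewrite -mulrBl funrposN -[in RHS](funrposBneg v).
Qed.

End JordanParts.

Section Priors.
Variables (R : realType) (K : R) (L : nat).
Hypothesis K_ge : 100 <= K.

Let weight (j : 'I_L.+3) : R := node_weight K L j.

Definition far_prior : {ffun 'I_L.+3 -> R} := jordan_pos weight.

Definition near_prior : {ffun 'I_L.+3 -> R} := jordan_neg weight.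

Lemma eq_moments_priors :
  eq_moments L.+2 (fun j : 'I_L.+3 => node K j) far_prior near_prior.
Proof.
by apply: eq_moments_jordan => [|t];
  [exact: sum_node_weight | exact: sum_node_weight_exp].
Qed.

Let mass_ge : 1 / 25 <= \sum_j weight^\+ j.
Proof.
rewrite (bigD1 ord0) //= ler_wpDr //.
  by apply: sumr_ge0 => j _; exact: funrpos_ge0.
by rewrite /funrpos /weight node_weight0 // le_max lexx.
Qed.

Let mass_neg : \sum_j (\- weight)^\+ j = \sum_j weight^\+ j.
Proof. exact/sum_funrposN/sum_node_weight. Qed.

Lemma far_priorP : is_distribution far_prior.
Proof. by apply: jordan_posP; have := mass_ge; lra. Qed.

Lemma near_priorP : is_distribution near_prior.
Proof. by apply: jordan_posP; rewrite mass_neg; have := mass_ge; lra. Qed.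

Hypothesis K_large : 200 * 100 <= K.

Lemma sum_tail_le (u h : nat -> R) :
  (forall j, u j <= `|node_weight K L j|) ->
  (forall k, 0 <= h k.+3 <= node K k.+3 - 1) ->
  \sum_(k < L) u k.+3 * h k.+3 <= 1 / 2500.
Proof.
move=> u_le h_itv; apply: (@le_trans _ _ (8 / K)); last first.
  by rewrite ler_pdivrMr; have := K_large; lra.
apply: le_trans (sum_tail_weight_le L K_ge); apply: ler_sum => k _.
have /andP[h0 h_le] := h_itv k.
apply: le_trans (ler_wpM2r h0 (u_le _)) _.
by rewrite ler_wpM2l.
Qed.

Lemma far_prior_node_neq0 :
  expect far_prior (fun j => (node K j != 0)%:R) <= 1 / 10.
Proof.
rewrite expect_jordan_pos ler_pdivrMr; last by have := mass_ge; lra.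
have : \sum_(k < L) (node_weight K L)^\+ k.+3 * (node K k.+3 != 0)%:R
    <= 1 / 2500.
  apply: (sum_tail_le (h := fun j => (node K j != 0)%:R)) => [j|k].
    by rewrite ge_max ler_norm normr_ge0.
  rewrite ler0n (@le_trans _ _ 1) ?lern1 ?leq_b1 //.
  by have := K_ge; have := node_ge K_ge k; lra.
rewrite (big_ord_recl3 +%R L xpredT
  (fun j => (node_weight K L)^\+ j * (node K j != 0)%:R)) /=.
have -> : (node_weight K L)^\+ 1%N = 0 by apply/max_idPr/node_weight1_le0.
have /andP[w2_ge0 w2_le] := node_weight2_bounds L K_ge.
have -> : (node_weight K L)^\+ 2%N = node_weight K L 2 by apply/max_idPl.
rewrite eqxx mulr0 mul0r !add0r (_ : 25 != 0 :> R) ?pnatr_eq0 // mulr1.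
have := mass_ge; lra.
Qed.

Lemma near_prior_node_dist1 :
  expect near_prior (fun j => `|node K j - 1|) <= 1 / 100.
Proof.
rewrite expect_jordan_pos mass_neg ler_pdivrMr; last by have := mass_ge; lra.
have : \sum_(k < L) (\- node_weight K L)^\+ k.+3 * `|node K k.+3 - 1|
    <= 1 / 2500.
  apply: (sum_tail_le (h := fun j => `|node K j - 1|)) => [j|k].
    by rewrite ge_max -normrN ler_norm normr_ge0.
  rewrite normr_ge0 ger0_norm ?lexx // subr_ge0.
  by apply: le_trans (node_ge K_ge k); have := K_ge; lra.
rewrite (big_ord_recl3 +%R L xpredT
  (fun j => (\- node_weight K L)^\+ j * `|node K j - 1|)) /=.
have -> : (\- node_weight K L)^\+ 0%N = 0.
  by apply/max_idPr; rewrite /= node_weight0 //; lra.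
have -> : (\- node_weight K L)^\+ 2%N = 0.
  apply/max_idPr; rewrite /= oppr_le0.
  by case/andP: (node_weight2_bounds L K_ge).
rewrite subrr normr0 !mul0r mulr0 !add0r.
have := mass_ge; lra.
Qed.

End Priors.

(** * The lower bound *)

Section SparseProducts.
Variables (R : realType) (n : nat) (eps : R).
Hypotheses (n_gt0 : (0 < n)%N) (eps_itv : 0 < eps <= 1 / 10).

Definition sparse_prod (y : 'I_n -> R) : {ffun cube n -> R} :=
  bern_prod (fun i => 4 * eps / n%:R * y i).

Definition avg (h : 'I_n -> R) : R := (\sum_i h i) / n%:R.

Lemma expect_avg (J : finType) (mu : {ffun J -> R}) (h : J -> R) :
  is_distribution mu ->
  expect (prod_distr (fun=> mu)) (fun a => avg (fun i => h (a i)))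
    = expect mu h.
Proof.
move=> mu_d; rewrite /avg; under eq_expect do rewrite mulrC.
rewrite expectZ expect_sum.
under eq_bigr do rewrite (expect_prod_distr _ h) //.
by rewrite sumr_const card_ord -[X in _ * X]mulr_natl mulKf // pnatr_eq0 -lt0n.
Qed.

Let n_ge1 : 1 <= n%:R :> R. Proof. by rewrite ler1n. Qed.

Let rate_itv : 0 <= 4 * eps / n%:R <= 1.
Proof.
have /andP[e0 e1] := eps_itv; have n1 := n_ge1.
by rewrite divr_ge0 ?ler_pdivrMr; lra.
Qed.

Lemma sparse_prod_cst1P : is_product_distribution (sparse_prod (fun=> 1)).
Proof. by apply: bern_prodP => _; rewrite mulr1. Qed.

Lemma l1dist_sparse_prod_le (y : 'I_n -> R) :
  (forall i, 0 <= 4 * eps / n%:R * y i <= 1) ->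
  l1dist (sparse_prod y) (sparse_prod (fun=> 1))
    <= 8 * eps * avg (fun i => `|y i - 1|).
Proof.
move=> y_itv; apply: le_trans (l1dist_bern_prod_le _ _) _ => [//|_|].
  by rewrite mulr1.
have /andP[rate_ge0 _] := rate_itv.
under eq_bigr do rewrite -mulrBr normrM (ger0_norm rate_ge0).
rewrite -mulr_sumr (_ : 8 * eps * avg _ = 2 * (4 * eps / n%:R *
  \sum_i `|y i - 1|)) //.
by rewrite /avg; ring.
Qed.

Lemma l1dist_sparse_prod_ge (y : 'I_n -> R) :
  4 * eps * (1 - 4 * eps) * (1 - avg (fun i => (y i != 0)%:R))
    <= l1dist (sparse_prod y) (sparse_prod (fun=> 1)).
Proof.
have n0 : n%:R != 0 :> R by rewrite pnatr_eq0 -lt0n.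
have rate0 : 4 * eps / n%:R != 0.
  by have /andP[e0 _] := eps_itv; rewrite mulf_neq0 ?invr_eq0 // gt_eqF //; lra.
apply: le_trans (l1dist_bern_prod_ge _ _) => [|_]; last by rewrite mulr1.
have -> : \sum_(i < n) 4 * eps / n%:R * 1 = 4 * eps.
  by rewrite sumr_const card_ord mulr1 -[LHS]mulr_natr divfK.
have -> : \sum_(i | 4 * eps / n%:R * y i == 0) 4 * eps / n%:R * 1
    = 4 * eps * (1 - avg (fun i => (y i != 0)%:R)).
  rewrite big_mkcond.
  transitivity (\sum_(i < n) 4 * eps / n%:R * (1 - (y i != 0)%:R)).
    apply: eq_bigr => i _; rewrite mulf_eq0 (negbTE rate0) /=.
    by case: eqP; rewrite ?subr0 // subrr mulr0.
  by rewrite -mulr_sumr sumrB sumr_const card_ord /avg; field.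
by rewrite mulrAC.
Qed.

End SparseProducts.

Definition tester_against (R : realType) (n : nat) (eps : R)
    (Q : {ffun cube n -> R}) (m : nat) (A : m.-tuple (cube n) -> R) : Prop :=
  (forall s, 0 <= A s <= 1) /\
  forall P : {ffun cube n -> R},
    is_product_distribution P ->
    correct_answer eps (l1dist P Q) (accept_prob P A).

Section TesterOnPriors.
Variables (R : realType) (n m : nat) (eps : R) (A : m.-tuple (cube n) -> R).
Hypotheses (n_gt0 : (0 < n)%N) (eps_itv : 0 < eps <= 1 / 10).
Hypothesis A_tester : tester_against eps (sparse_prod eps (fun=> 1)) A.
Variables (J : finType) (x : J -> R) (mu : {ffun J -> R}).
Hypothesis x_itv : forall j, 0 <= 4 * eps / n%:R * x j <= 1.
Hypothesis mu_d : is_distribution mu.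

Let kern j := bern (4 * eps / n%:R * x j).

Let instance (a : {ffun 'I_n -> J}) := sparse_prod eps (fun i => x (a i)).

Let instanceP a : is_product_distribution (instance a).
Proof. by apply: bern_prodP => i; exact: x_itv. Qed.

Let accept_itv a : 0 <= accept_prob (instance a) A <= 1.
Proof.
by apply: accept_prob_itv => [|s]; [case: (instanceP a) | case: A_tester].
Qed.

Lemma mean_accept_ge :
  2 / 3 * (1 - 16 * expect mu (fun j => `|x j - 1|)) <= mean_accept kern A mu.
Proof.
have /andP[e0 e1] := eps_itv.
pose dist1 (a : {ffun 'I_n -> J}) := avg (fun i => `|x (a i) - 1|).
have dist1_mean : expect (prod_distr (fun=> mu)) dist1
    = expect mu (fun j => `|x j - 1|) by exact: expect_avg.
rewrite -dist1_mean.
rewrite (_ : 16 * _ = expect (prod_distr (fun=> mu)) dist1 / 16^-1); last first.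
  by field.
apply: expect_markov => [||| a | a | a dist1_lt]; first exact: prod_distrP.
- lra.
- lra.
- by rewrite divr_ge0 ?sumr_ge0.
- by case/andP: (accept_itv a).
case: A_tester => _ /(_ _ (instanceP a))[close _]; apply: close.
apply: le_lt_trans (l1dist_sparse_prod_le n_gt0 eps_itv _) _ => [i|].
  exact: x_itv.
rewrite -/(dist1 a) (_ : eps / 2 = 8 * eps * 16^-1); last by field.
by rewrite ltr_pM2l //; lra.
Qed.

Lemma mean_accept_le :
  mean_accept kern A mu
    <= 1 - 2 / 3 * (1 - 2 * expect mu (fun j => (x j != 0)%:R)).
Proof.
have /andP[e0 e1] := eps_itv.
pose support (a : {ffun 'I_n -> J}) : R := avg (fun i => (x (a i) != 0)%:R).
have support_mean : expect (prod_distr (fun=> mu)) support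
    = expect mu (fun j => (x j != 0)%:R).
  exact: (expect_avg n_gt0 (fun j => (x j != 0)%:R)).
have product_d : is_distribution (prod_distr (fun _ : 'I_n => mu)).
  exact: prod_distrP.
rewrite lerBrDl -lerBrDr -support_mean.
rewrite (_ : 2 * _ = expect (prod_distr (fun=> mu)) support / 2^-1); last first.
  by field.
rewrite -[X in _ <= X - _](expect_cst 1 product_d) -expectB.
apply: expect_markov => [//||| a | a | a support_lt].
- lra.
- lra.
- by rewrite divr_ge0 ?sumr_ge0.
- by rewrite subr_ge0; case/andP: (accept_itv a).
case: A_tester => _ /(_ _ (instanceP a))[_ far]; apply: far.
apply: lt_le_trans (l1dist_sparse_prod_ge n_gt0 eps_itv _).
rewrite -/(support a).
have : 0 < eps * ((1 - 4 * eps) * (2^-1 - support a)).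
  by rewrite !mulr_gt0 //; lra.
have : 0 < eps * (1 / 2 - 4 * eps) by rewrite mulr_gt0 //; lra.
lra.
Qed.

End TesterOnPriors.

Lemma expR_half_le2 (R : realType) : expR (1 / 2) <= 2 :> R.
Proof.
have := @expR_ge1Dx R (- (1 / 2)); rewrite expRN -[(expR _)^-1]mul1r.
by rewrite ler_pdivlMr ?expR_gt0 //; lra.
Qed.

Lemma expr1D_le_exp2 (R : realType) (y : R) (m L : nat) :
  0 <= y -> 2 * (y * m%:R) <= L%:R -> (1 + y) ^+ m <= 2 ^+ L.
Proof.
move=> y0 ymL; apply: (@le_trans _ _ (expR y ^+ m)).
  by rewrite lerXn2r ?nnegrE ?expR_ge0 ?expR_ge1Dx //; lra.
rewrite -expRM_natr; apply: (@le_trans _ _ (expR (1 / 2 * L%:R))).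
  by rewrite ler_expR; lra.
by rewrite expRM_natr lerXn2r ?nnegrE ?expR_ge0 // expR_half_le2.
Qed.

Lemma sqr_ln_le (R : realType) (c x : R) : 0 <= c -> 0 < x -> 6 * c <= ln x ->
  c * ln x ^+ 2 <= x.
Proof.
move=> c0 x0 ln_ge; have ln0 : 0 <= ln x by lra.
have := expR_ge1Dxn 2 ln0; rewrite lnK ?posrE // => /(le_trans _); apply.
have : 6 * c * ln x ^+ 2 <= ln x * ln x ^+ 2 by rewrite ler_wpM2r ?sqr_ge0.
by rewrite -exprS (_ : (2.+1)`!%:R = 6) //; lra.
Qed.

Lemma up_log2_le_ln (R : realType) (n : nat) : (1 < n)%N -> 1 <= ln n%:R :> R ->
  (up_log 2 n)%:R <= 4 * ln n%:R :> R.
Proof.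
move=> n1 ln1; case: (up_log 2 n) (up_log_gtn (ltnSn 1) n1) => [|l] /= l_lt.
  lra.
have : ln ((2 ^ l)%:R) <= ln n%:R :> R.
  by rewrite ler_ln ?posrE ?ltr0n ?expn_gt0 ?(ltnW n1) // ler_nat ltnW.
rewrite natrX lnXn // -[_ *+ l]mulr_natr => ln_le.
have ln2 : 1 / 2 <= ln 2 :> R.
  by rewrite -[1 / 2]expRK ler_ln ?posrE ?expR_gt0 // expR_half_le2.
by rewrite -[l.+1%:R]natr1; have := ler_wpM2r (ler0n R l) ln2; lra.
Qed.

Section NoTester.
Variables (R : realType) (K : R) (n m L : nat) (eps : R).
Hypotheses (K_large : 200 * 100 <= K) (L_gt0 : (0 < L)%N).
Hypotheses (n_gt0 : (0 < n)%N) (n_le : (n <= 2 ^ L)%N).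
Hypothesis eps_itv : 0 < eps <= 1 / 10.
Hypothesis node_max_le : K * L%:R ^+ 2 <= n%:R.
Hypothesis m_le : 16 * K * L%:R * m%:R <= n%:R.

Let bias (j : 'I_L.+3) : R := 4 * eps / n%:R * node K j.

Let K_ge : 100 <= K. Proof. have := K_large; lra. Qed.

Let n_gt0R : 0 < n%:R :> R. Proof. by rewrite ltr0n. Qed.

Lemma bias_itv j : 0 <= bias j <= K * L%:R ^+ 2 / n%:R.
Proof.
have /andP[node_ge0 node_le] := node_le K_ge L_gt0 (ltn_ord j).
have /andP[e0 e1] := eps_itv.
rewrite /bias mulrAC divr_ge0 ?mulr_ge0 ?(ltW e0) //=.
rewrite ler_wpM2r ?invr_ge0 ?ler0n //.
by apply: le_trans node_le; rewrite ler_piMl //; lra.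
Qed.

Lemma bias_le1 j : 0 <= bias j <= 1.
Proof.
have /andP[-> bias_le] := bias_itv j; apply: le_trans bias_le _.
by rewrite ler_pdivrMr // mul1r.
Qed.

Lemma prior_columns_close :
  n%:R * l1dist (column_law (fun j => bern (bias j)) m (far_prior K L))
                (column_law (fun j => bern (bias j)) m (near_prior K L))
    <= 1 / 16.
Proof.
set b := K * L%:R ^+ 2 / n%:R.
have b_ge0 : 0 <= b.
  by rewrite divr_ge0 ?mulr_ge0 ?sqr_ge0 ?ler0n //; have := K_ge; lra.
have r_ge1 : 1 <= 4 :> R by lra.
have bias_moments : eq_moments L.+2 bias (far_prior K L) (near_prior K L).
  exact: eq_momentsZ (eq_moments_priors K_ge).
have columns_le := l1dist_column_law_le m (far_priorP L K_ge)
  (near_priorP L K_ge) bias_itv r_ge1 bias_moments b_ge0.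
apply: le_trans (ler_wpM2l (ltW n_gt0R) columns_le) _.
have growth : (1 + 2 * 4 * b) ^+ m <= 2 ^+ L.
  apply: expr1D_le_exp2; first lra.
  rewrite (_ : 2 * _ = 16 * K * L%:R * m%:R / n%:R * L%:R); last first.
    by rewrite /b; ring.
  by rewrite ler_piMl // ler_pdivrMr // mul1r.
rewrite -/b [leLHS]mulrA ler_pdivrMr ?exprn_gt0 //.
rewrite [X in X ^+ L.+2](_ : 4 = 2 * 2 :> R); last by ring.
rewrite exprMn [2 ^+ L.+2]exprS [2 ^+ L.+1]exprS.
have : n%:R * (1 + 2 * 4 * b) ^+ m <= 2 ^+ L * 2 ^+ L.
  by rewrite ler_pM ?ler0n ?exprn_ge0 -?natrX ?ler_nat //; [lra|rewrite natrX].
lra.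
Qed.

Lemma no_tester_against (A : m.-tuple (cube n) -> R) :
  ~ tester_against eps (sparse_prod eps (fun=> 1)) A.
Proof.
move=> A_tester.
have far_d := far_priorP L K_ge; have near_d := near_priorP L K_ge.
have near_accept := mean_accept_ge n_gt0 eps_itv A_tester bias_le1 near_d.
have far_accept := mean_accept_le n_gt0 eps_itv A_tester bias_le1 far_d.
have A01 : forall s, 0 <= A s <= 1 by case: A_tester.
have accept_dist := dist_mean_accept_le (fun j => bernP (bias_le1 j))
  far_d near_d A01.
have accept_close := le_trans accept_dist prior_columns_close.
rewrite distrC in accept_close.
have := le_trans (ler_norm _) accept_close.
have := far_prior_node_neq0 L K_ge K_large.
have := near_prior_node_dist1 L K_ge K_large.
lra.
Qed.

End NoTester.

Lemma tester_against_sample_ge (R : realType) (K : R) (n m : nat) (eps : R)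
    (A : m.-tuple (cube n) -> R) :
  200 * 100 <= K -> 96 * K <= ln n%:R -> 0 < eps <= 1 / 10 ->
  tester_against eps (sparse_prod eps (fun=> 1)) A ->
  (64 * K)^-1 * (n%:R / ln n%:R) <= m%:R.
Proof.
move=> K_large ln_ge eps_itv A_tester; rewrite leNgt; apply/negP => m_lt.
have n_gt1 : (1 < n)%N.
  rewrite ltnNge; apply/negP; rewrite -(lern1 R) => /ln_le0; lra.
have n0 : 0 < n%:R :> R by rewrite ltr0n ltnW.
have L_le : (up_log 2 n)%:R <= 4 * ln n%:R :> R.
  by apply: up_log2_le_ln => //; lra.
apply: (no_tester_against K_large _ _ _ eps_itv _ _ A_tester (L := up_log 2 n)).
- by rewrite up_log_gt0.
- exact: ltnW.
- exact: up_logP.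
- apply: le_trans (sqr_ln_le (c := 16 * K) _ n0 _); [|lra|lra].
  rewrite [leRHS](_ : _ = K * (4 * ln n%:R) ^+ 2); last by ring.
  by rewrite ler_pM2l ?lerXn2r ?nnegrE //; lra.
have : 64 * K * ln n%:R * m%:R <= n%:R.
  move: m_lt; rewrite mulrCA -invfM ltr_pdivlMr.
    by rewrite mulrC => /ltW.
  by rewrite mulr_gt0; lra.
apply: le_trans; rewrite ler_wpM2r //.
rewrite (_ : 64 * K * ln n%:R = 16 * K * (4 * ln n%:R)); last by ring.
by rewrite ler_pM2l //; lra.
Qed.

Lemma accept_prob2E (R : realType) (T : finType) (P Q : {ffun T -> R})
    (mP mQ : nat) (A : mP.-tuple T -> mQ.-tuple T -> R) :
  accept_prob2 P Q A = accept_prob P (fun s => accept_prob Q (A s)).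
Proof.
apply: eq_bigr => s _; rewrite mulr_sumr; apply: eq_bigr => t _.
by rewrite mulrA.
Qed.

Lemma closeness_tester_against (R : realType) (n : nat) (eps : R) (mP mQ : nat)
    (A : mP.-tuple (cube n) -> mQ.-tuple (cube n) -> R)
    (Q : {ffun cube n -> R}) :
  is_product_distribution Q -> closeness_tester eps A ->
  tester_against eps Q (fun s => accept_prob Q (A s)).
Proof.
move=> Qd [A01 correct]; split=> [s|P Pd].
  by apply: accept_prob_itv => //; case: Qd.
by rewrite -accept_prob2E; apply: correct.
Qed.

Lemma identity_tester_against (R : realType) (n : nat) (eps : R) (m : nat)
    (A : {ffun cube n -> R} -> m.-tuple (cube n) -> R)
    (Q : {ffun cube n -> R}) :
  is_product_distribution Q -> identity_tester eps A ->
  tester_against eps Q (A Q).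
Proof. by move=> Qd [A01 correct]; split=> [s|P Pd]; last exact: correct. Qed.

Theorem theorem4p28 (R : realType) :
  exists eps0 : R, 0 < eps0 < 1 /\
  exists (c : R) (N : nat), 0 < c /\
  forall (n : nat) (eps : R), (N <= n)%N -> 0 < eps <= eps0 ->
    (forall (mP mQ : nat)
            (A : mP.-tuple (cube n) -> mQ.-tuple (cube n) -> R),
       closeness_tester eps A -> c * (n%:R / ln n%:R) <= (mP + mQ)%:R) /\
    (forall (m : nat)
            (A : {ffun cube n -> R} -> m.-tuple (cube n) -> R),
       identity_tester eps A -> c * (n%:R / ln n%:R) <= m%:R).
Proof.
exists (1 / 10); split; first lra.
have [K K_large] : exists K : R, 200 * 100 <= K by exists (200 * 100).
exists (64 * K)^-1, (Num.bound (expR (96 * K))); split.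
  by rewrite invr_gt0; lra.
move=> n eps N_le_n eps_itv.
have n_ge : expR (96 * K) <= n%:R.
  by rewrite (le_trans (ltW (archi_boundP (expR_ge0 _)))) // ler_nat.
have n_gt0 : 0 < n%:R :> R by apply: lt_le_trans (expR_gt0 _) n_ge.
have ln_ge : 96 * K <= ln n%:R by rewrite -[leLHS]expRK ler_ln ?posrE ?expR_gt0.
have Q_product : is_product_distribution (sparse_prod eps (fun _ : 'I_n => 1)).
  by apply: sparse_prod_cst1P => //; rewrite -(ltr0n R).
split=> [mP mQ A A_tester|m A A_tester].
  apply: le_trans (tester_against_sample_ge K_large ln_ge eps_itv
    (closeness_tester_against Q_product A_tester)) _.
  by rewrite ler_nat leq_addr.
exact: (tester_against_sample_ge K_large ln_ge eps_itv
  (identity_tester_against Q_product A_tester)).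
Qed.
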